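(* Let $Z$ be an antipodal space and let $\rho\in\mathcal{M}(Z)$. Then the tangent space to $\mathcal{M}(Z)$ at $\rho$ is equal to the set of $\rho$-odd functions, $T_\rho\mathcal{M}(Z)=\mathcal{O}_\rho(Z)$. In particular, $T_\rho\mathcal{M}(Z)$ is a closed linear subspace of $C(Z)$, and is hence a Banach space.
   Context: Antipodal spaces and Moebius spaces. Let $Z$ be a compact metrizable space containing at least four points. A separating function on $Z$ is a continuous function $\rho : Z\times Z\to[0,\infty)$ which is symmetric and satisfies $\rho(\xi,\eta)=0$ if and only if $\xi=\eta$. Its cross-ratio is defined on quadruples of distinct points of $Z$ by $[\xi,\xi',\eta,\eta']_\rho=\frac{\rho(\xi,\eta)\rho(\xi',\eta')}{\rho(\xi,\eta')\rho(\xi',\eta)}$. Two separating functions are Moebius equivalent if their cross-ratios agree. If $\rho_1,\rho_2$ are Moebius equivalent, there is a unique positive continuous function $\frac{d\rho_2}{d\rho_1}:Z\to(0,\infty)$, the derivative, such that $\rho_2(\xi,\eta)^2=\frac{d\rho_2}{d\rho_1}(\xi)\frac{d\rho_2}{d\rho_1}(\eta)\rho_1(\xi,\eta)^2$ for all $\xi,\eta\in Z$. An antipodal function on $Z$ is a separating function $\rho$ such that $\sup_{\xi,\eta}\rho(\xi,\eta)=1$ and for every $\xi\in Z$ there is $\eta\in Z$ with $\rho(\xi,\eta)=1$. An antipodal space $(Z,\rho_0)$ is such a space $Z$ equipped with an antipodal function $\rho_0$. Its Moebius space $\mathcal{M}(Z)=\mathcal{M}(Z,\rho_0)$ is the set of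 all antipodal functions on $Z$ Moebius equivalent to $\rho_0$, with the metric $d_{\mathcal{M}}(\rho_1,\rho_2)=\left\|\log\frac{d\rho_2}{d\rho_1}\right\|_\infty$. $C(Z)$ is the Banach space of real continuous functions on $Z$ with the sup norm. For $\rho\in\mathcal{M}(Z)$, $\phi_\rho:\mathcal{M}(Z)\to C(Z)$ is the isometric embedding $\phi_\rho(\beta)=\log\frac{d\beta}{d\rho}$. A curve $t\in(-\epsilon,\epsilon)\mapsto\rho(t)\in\mathcal{M}(Z)$ is admissible at $\rho$ if $\rho(0)=\rho$ and the derivative $\frac{d}{dt}\big|_{t=0}\phi_\rho(\rho(t))$ exists in $C(Z)$. The tangent space $T_\rho\mathcal{M}(Z)\subset C(Z)$ is the set of all $v=\frac{d}{dt}\big|_{t=0}\phi_\rho(\rho(t))$ over curves admissible at $\rho$. A function $v\in C(Z)$ is $\rho$-odd if $v(\xi)+v(\eta)=0$ whenever $\xi,\eta\in Z$ satisfy $\rho(\xi,\eta)=1$; $\mathcal{O}_\rho(Z)$ is the set of $\rho$-odd functions. *)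

(* Defs.v *)
From HB Require Import structures.
From mathcomp Require Import all_boot all_order all_algebra.
From mathcomp Require Import all_classical all_reals all_analysis.
From mathcomp Require Import lra.
Set Implicit Arguments.
Unset Strict Implicit.
Unset Printing Implicit Defensive.
Import Order.TTheory GRing.Theory Num.Theory.
Import numFieldNormedType.Exports.
Local Open Scope classical_set_scope.
Local Open Scope ring_scope.

Definition metrizable (R : realType) (Z : topologicalType) : Prop :=
  exists d : Z -> Z -> R,
    [/\ forall x y, d x y = 0 <-> x = y,
        forall x y, d x y = d y x,
        forall x y z, d x z <= d x y + d y z
      & forall (x : Z) (A : set Z),
          nbhs x A <-> exists2 e : R, 0 < e & [set y | d x y < e] `<=` A].

HB.mixin Record isCompactMetrizable (R : realType) Z & Topological Z := {
  compact_setT : compact [set: Z];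
  metrizable_setT : metrizable R Z
}.

#[short(type="compactMetrizableType")]
HB.structure Definition CompactMetrizable (R : realType) :=
  {Z of Topological Z & isCompactMetrizable R Z}.

(* C(Z), given below the pointwise operations and the sup norm. *)
Definition cfun (R : realType) (Z : compactMetrizableType R) : Type :=
  continuousType Z R.

Section cfun_module.
Context {R : realType} {Z : compactMetrizableType R}.
Implicit Types f g h : continuousType Z R.

HB.instance Definition _ := Choice.on (cfun Z).

Let cfun_eqP f g : f =1 g -> f = g. Proof. by move/continuousEP. Qed.

Let cst0_continuous : continuous (fun _ : Z => 0 : R).
Proof. by move=> x; exact: cvg_cst. Qed.
Let add_continuous f g : continuous (fun x => f x + g x).
Proof. by move=> x; apply: cvgD; exact: cts_fun. Qed.
Let opp_continuous f : continuous (fun x => - f x).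
Proof. by move=> x; apply: cvgN; exact: cts_fun. Qed.
Let scale_continuous (a : R) f : continuous (fun x => a * f x).
Proof. by move=> x; apply: cvgMl_tmp; exact: cts_fun. Qed.

Let zero : continuousType Z R := mkcts cst0_continuous.
Let add f g : continuousType Z R := mkcts (@add_continuous f g).
Let opp f : continuousType Z R := mkcts (@opp_continuous f).
Let scale a f : continuousType Z R := mkcts (@scale_continuous a f).

Let addA : associative add.
Proof. by move=> f g h; apply: cfun_eqP => x; exact: addrA. Qed.
Let addC : commutative add.
Proof. by move=> f g; apply: cfun_eqP => x; exact: addrC. Qed.
Let add0 : left_id zero add.
Proof. by move=> f; apply: cfun_eqP => x; exact: add0r. Qed.
Let addN : left_inverse zero opp add.
Proof. by move=> f; apply: cfun_eqP => x; exact: addNr. Qed.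

HB.instance Definition _ := GRing.isZmodule.Build (cfun Z) addA addC add0 addN.

Let scaleA a b (f : cfun Z) : scale a (scale b f) = scale (a * b) f.
Proof. by apply: cfun_eqP => x; exact: mulrA. Qed.
Let scale1 : left_id 1 scale.
Proof. by move=> f; apply: cfun_eqP => x; exact: mul1r. Qed.
Let scaleDr : right_distributive scale (+%R : cfun Z -> cfun Z -> cfun Z).
Proof. by move=> a f g; apply: cfun_eqP => x; exact: mulrDr. Qed.
Let scaleDl (f : cfun Z) :
  {morph scale^~ f : a b / a + b >-> (a : cfun Z) + (b : cfun Z)}.
Proof. by move=> a b; apply: cfun_eqP => x; exact: mulrDl. Qed.

HB.instance Definition _ :=
  GRing.Zmodule_isLmodule.Build R (cfun Z) scaleA scale1 scaleDr scaleDl.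

Definition sup_norm (f : cfun Z) : R := sup (range (fun x => `|f x|)).

End cfun_module.

Section cfun_theory.
Context {R : realType} {Z : compactMetrizableType R}.
Implicit Types f g : cfun Z.

Lemma cfunP f g : f =1 g -> f = g. Proof. by move/continuousEP. Qed.

Lemma cfun_continuous f : continuous f.
Proof. exact: cts_fun. Qed.

Lemma cfun0E x : (0 : cfun Z) x = 0. Proof. by []. Qed.
Lemma cfunDE f g x : (f + g) x = f x + g x. Proof. by []. Qed.
Lemma cfunNE f x : (- f) x = - f x. Proof. by []. Qed.
Lemma cfunBE f g x : (f - g) x = f x - g x. Proof. by []. Qed.
Lemma cfunZE a f x : (a *: f) x = a * f x. Proof. by []. Qed.

Let abs_has_ubound f : has_ubound (range (fun x => `|f x|)).
Proof.
have /compact_bounded[M [_ bM]] : compact (f @` [set: Z]).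
  apply: continuous_compact; last exact: compact_setT.
  by apply: continuous_subspaceT; exact: cfun_continuous.
exists (M + 1) => _ [x _ <-]; apply: (bM (M + 1)); first by rewrite ltrDl.
by exists x.
Qed.

Lemma abs_le_sup_norm f x : `|f x| <= sup_norm f.
Proof. by apply: ub_le_sup => //; exists x. Qed.

Lemma sup_norm_le f (M : R) :
  0 <= M -> (forall x, `|f x| <= M) -> sup_norm f <= M.
Proof.
move=> M0 fM; rewrite /sup_norm.
have [->|/set0P ne] := eqVneq (range (fun x => `|f x|)) set0; first by rewrite sup0.
by apply: ge_sup => // _ [x _ <-].
Qed.

Lemma sup_norm_ge0 f : 0 <= sup_norm f.
Proof.
rewrite /sup_norm.
have [->|/set0P[y [x _ _]]] := eqVneq (range (fun x => `|f x|)) set0.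
  by rewrite sup0.
exact: le_trans (abs_le_sup_norm f x).
Qed.

Let sup_normD f g : sup_norm (f + g) <= sup_norm f + sup_norm g.
Proof.
apply: sup_norm_le => [|x]; first by rewrite addr_ge0 ?sup_norm_ge0.
by rewrite (le_trans (ler_normD _ _))// lerD// abs_le_sup_norm.
Qed.

Let sup_normZ (a : R) f : sup_norm (a *: f) = `|a| * sup_norm f.
Proof.
have le_scale (b : R) g : sup_norm (b *: g) <= `|b| * sup_norm g.
  apply: sup_norm_le => [|x]; first by rewrite mulr_ge0 ?sup_norm_ge0.
  by rewrite cfunZE normrM ler_wpM2l// abs_le_sup_norm.
apply/eqP; rewrite eq_le le_scale/=.
have [->|a0] := eqVneq a 0; first by rewrite normr0 mul0r sup_norm_ge0.
rewrite -ler_pdivlMl ?normr_gt0// -normfV.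
by rewrite -[X in sup_norm X <= _](scalerK a0).
Qed.

Let sup_norm_eq0 f : sup_norm f = 0 -> f = 0.
Proof.
move=> f0; apply: cfunP => x; apply/normr0_eq0/eqP.
by rewrite eq_le normr_ge0 andbT -f0 abs_le_sup_norm.
Qed.

HB.instance Definition _ :=
  Lmodule_isNormed.Build R (cfun Z) sup_normD sup_normZ sup_norm_eq0.

Lemma cfun_normE f : `|f| = sup (range (fun x => `|f x|)).
Proof. by []. Qed.

Let cfun_complete (F : set_system (cfun Z)) :
  ProperFilter F -> cauchy F -> cvg F.
Proof.
move=> FF /cauchyP Fc.
have near_sup (e : R) : 0 < e ->
    exists f : cfun Z, F [set g : cfun Z | forall x, `|f x - g x| < e].
  move=> e0; have [f Ff] := Fc e e0; exists f.
  apply: filterS Ff => g; rewrite -ball_normE /= => fg x.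
  exact: le_lt_trans (abs_le_sup_norm (f - g) x) fg.
have cvgx x : cvg ((fun f : cfun Z => f x) @ F).
  apply: cauchy_cvg; apply/cauchyP => e e0.
  have [f Ff] := near_sup e e0; exists (f x).
  suff: F [set g : cfun Z | ball (f x) e (g x)] by [].
  by apply: filterS Ff => g fg; exact: fg.
pose l x : R := lim ((fun f : cfun Z => f x) @ F).
have lim_le (f : cfun Z) (e : R) :
    F [set g : cfun Z | forall x, `|f x - g x| < e] ->
    forall x, `|f x - l x| <= e.
  move=> Ff x; have fgx : (fun g : cfun Z => `|f x - g x|) @ F --> `|f x - l x|.
    by apply: cvg_norm; apply: cvgB; [exact: cvg_cst|exact: cvgx].
  apply: (cvgr_to_le fgx); by apply: filterS Ff => g /(_ x)/ltW.
have l_cont : continuous l.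
  move=> x; apply/cvgrPdist_lt => e e0.
  have e3 : 0 < e / 3 by rewrite divr_gt0.
  have [f /lim_le fl] := near_sup _ e3.
  have /cvgrPdist_lt/(_ _ e3) := @cfun_continuous f x.
  apply: filterS => y fxy.
  have := ler_distD (f x) (l x) (l y); have := ler_distD (f y) (f x) (l y).
  have := fl x; have := fl y; rewrite (distrC (f x) (l x)).
  move=> /=; lra.
pose L : cfun Z := @mkcts Z R l l_cont.
apply/cvg_ex; exists L; apply/cvgrPdist_lt => e e0.
have e4 : 0 < e / 4 by rewrite divr_gt0.
have [f Ff] := near_sup _ e4; have fl := lim_le _ _ Ff.
apply: filterS Ff => g fg.
apply: (@le_lt_trans _ _ (e / 2)); last by lra.
apply: sup_norm_le => [|x]; first by lra.
rewrite cfunBE; have := fg x; have := fl x.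
have := ler_distD (f x) (l x) (g x); rewrite (distrC (l x) (f x)) /L /=.
lra.
Qed.

HB.instance Definition _ := Uniform_isComplete.Build (cfun Z) cfun_complete.

End cfun_theory.

Section antipodal.
Context {R : realType} {Z : compactMetrizableType R}.
Implicit Types rho beta : Z -> Z -> R.

Definition separating rho : Prop :=
  [/\ continuous (fun p : Z * Z => rho p.1 p.2),
      forall x y, 0 <= rho x y,
      forall x y, rho x y = rho y x
    & forall x y, rho x y = 0 <-> x = y].

Definition cross_ratio rho (x x' y y' : Z) : R :=
  (rho x y * rho x' y') / (rho x y' * rho x' y).

Definition moebius_equivalent rho1 rho2 : Prop :=
  forall x x' y y' : Z, uniq [:: x; x'; y; y'] ->
    cross_ratio rho1 x x' y y' = cross_ratio rho2 x x' y y'.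

Definition antipodal rho : Prop :=
  [/\ separating rho,
      sup (range (fun p : Z * Z => rho p.1 p.2)) = 1
    & forall x, exists y, rho x y = 1].

Definition moebius_space rho0 : set (Z -> Z -> R) :=
  [set rho | antipodal rho /\ moebius_equivalent rho rho0].

Definition is_moebius_derivative rho1 rho2 (f : Z -> R) : Prop :=
  [/\ continuous f, forall x, 0 < f x
    & forall x y, rho2 x y ^+ 2 = f x * f y * rho1 x y ^+ 2].

(* d rho2 / d rho1. The default value 1 is irrelevant: for Moebius equivalent
   separating functions on a space with at least four points there is exactly
   one f such that [is_moebius_derivative rho1 rho2 f]. *)
Definition moebius_derivative rho1 rho2 : Z -> R :=
  xget (fun=> 1) [set f | is_moebius_derivative rho1 rho2 f].

Lemma log_moebius_derivative_continuous rho1 rho2 :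
  continuous (fun x => ln (moebius_derivative rho1 rho2 x)).
Proof.
have [cf f0] : continuous (moebius_derivative rho1 rho2) /\
    forall x, 0 < moebius_derivative rho1 rho2 x.
  rewrite /moebius_derivative.
  case: xgetP => [f _ [cf f0 _]|_]; first by split.
  by split=> // x; exact: cvg_cst.
by move=> x; apply: continuous_comp; [exact: cf|exact: continuous_ln].
Qed.

(* phi_rho(beta) = log (d beta / d rho) *)
Definition phi rho beta : cfun Z :=
  mkcts (@log_moebius_derivative_continuous rho beta).

(* A curve defined on ]-eps, eps[ is represented by a function on R whose
   values outside that interval are irrelevant. *)
Definition admissible_curve rho0 rho (eps : R) (c : R -> Z -> Z -> R) : Prop :=
  [/\ 0 < eps, forall t, t \in `]- eps, eps[ -> moebius_space rho0 (c t),
      c 0 = rho & derivable (fun t : R => phi rho (c t)) 0 1].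

Definition tangent_space rho0 rho : set (cfun Z) :=
  [set v : cfun Z | exists eps c, admissible_curve rho0 rho eps c /\
                         v = 'D_1 (fun t : R => phi rho (c t)) 0].

Definition odd_functions rho : set (cfun Z) :=
  [set v : cfun Z | forall x y, rho x y = 1 -> v x + v y = 0].

End antipodal.

Definition complete_set (V : uniformType) (A : set V) : Prop :=
  forall F : set_system V, ProperFilter F -> F A -> cauchy F ->
    exists2 l, A l & F --> l.

(* Main.v *)
Require Import Defs.
From HB Require Import structures.
From mathcomp Require Import all_boot all_order all_algebra.
From mathcomp Require Import all_classical all_reals all_analysis.
From mathcomp Require Import lra.
Import Order.TTheory GRing.Theory Num.Theory.
Import numFieldNormedType.Exports.
Local Open Scope classical_set_scope.
Local Open Scope ring_scope.

(** The logarithm of a derivative turns the multiplicative picture into an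
    additive one: the function [rescale rho f], whose square is
    rho(x,y)^2 exp(-(f x + f y)), is Moebius equivalent to [rho] and has
    log-derivative -f with respect to [rho] ([phi_rescale]). It is antipodal
    exactly when f is its own conjugate, where the conjugate of f is the function
    x |-> max_y (ln rho(x,y)^2 - f y); such an f is called tight below. This is
    the description of extremal functions in Isbell's injective hull, with
    ln rho^2 in place of the distance.

    Tangent vectors are odd. If rho(x,y) = 1 and [c] is a curve through [rho],
    the number phi(c t)(x) + phi(c t)(y) = ln (c t)(x,y)^2 is at most 0 and
    vanishes at t = 0, so its derivative at 0 vanishes.

    Odd functions are tangent. Let v be odd. The straight line t |-> t v need not
    stay in the Moebius space, so for each t the function u = - t v is replaced
    by a tight function near it. Every u at most its conjugate u' has a tight
    function within 2 |u' - u| ([tight_near_exists]): averaging a function with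
    its conjugate halves the gap between the two, so the iterated averages
    converge geometrically, and the limit is tight. It remains to see that the
    gap of - t v is o(t) ([odd_small_gap]). Near the pairs with rho = 1 the sum
    v x + v y is close to 0 because v is odd, and away from them rho^2 is less
    than a constant smaller than 1, so these pairs do not matter for small t;
    compactness of Z * Z makes this uniform. The rescalings of [rho] by the
    chosen tight functions thus form a curve with velocity v.

    Oddness is a family of closed linear conditions on v, and C(Z) is complete,
    which gives the remaining claims. *)

(** * Conjugate functions *)

Definition dominated {R : realType} {Z : compactMetrizableType R}
    (rho : Z -> Z -> R) (f g : Z -> R) : Prop :=
  forall x y, rho x y ^+ 2 <= expR (f x + g y).

(** The conjugate of f is x |-> max_y (ln rho(x,y)^2 - f y). Writing it with
    exponentials avoids the value ln 0 on the diagonal. *)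
Definition is_conjugate {R : realType} {Z : compactMetrizableType R}
    (rho : Z -> Z -> R) (f g : cfun Z) : Prop :=
  dominated rho g f /\ forall x, exists y, rho x y ^+ 2 = expR (g x + f y).

Definition tight {R : realType} {Z : compactMetrizableType R}
    (rho : Z -> Z -> R) (f : cfun Z) : Prop :=
  is_conjugate rho f f.

(** A maximum over a compact factor is continuous: by compactness, K x' y is
    uniformly close to K x y in y when x' is close to x. *)
Lemma max_continuous {R : realType} {Z : compactMetrizableType R}
    (K : Z -> Z -> R) (m : Z -> R) :
  continuous (fun p : Z * Z => K p.1 p.2) ->
  (forall x y, K x y <= m x) -> (forall x, exists y, K x y = m x) ->
  continuous m.
Proof.
move=> Kc Km mK x; apply/cvgrPdist_lt => e e0.
have cov : near_covering [set: Z].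
  exact/compact_near_coveringP/compact_setT.
have e2 : 0 < e / 2 by rewrite divr_gt0.
have : \forall x' \near x, [set: Z] `<=` (fun y => `|K x y - K x' y| < e).
  apply: cov => y _.
  have /cvgrPdist_lt/(_ _ e2) [[A B] /= [xA yB] AB] := Kc (x, y).
  exists (B, A) => //= -[y' x'] /= [By' Ax'].
  have h1 : `|K x y - K x' y'| < e / 2 := AB (x', y') (conj Ax' By').
  have h2 : `|K x y - K x y'| < e / 2 :=
    AB (x, y') (conj (nbhs_singleton xA) By').
  have := ler_distD (K x y) (K x y') (K x' y').
  rewrite (distrC (K x y') (K x y)); lra.
apply: filterS => x' /= cl.
have [y yE] := mK x; have [y' yE'] := mK x'.
have h1 : `|K x y - K x' y| < e by exact: cl.
have h2 : `|K x y' - K x' y'| < e by exact: cl.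
move: h1 h2 (Km x y') (Km x' y); rewrite yE yE' !ltr_norml => /andP[? ?] /andP[? ?].
move=> ? ?; apply/andP; split; lra.
Qed.

(** The maximum of rho(x,y)^2 exp(-f y) over y is attained, continuous in x, and
    positive since some y differs from x; hence its logarithm lies in C(Z). *)
Lemma conjugate_exists {R : realType} {Z : compactMetrizableType R}
    (rho : Z -> Z -> R) (f : cfun Z) :
  separating rho -> (forall x : Z, exists y, x <> y) ->
  exists g, is_conjugate rho f g.
Proof.
move=> [rc r0 rs r1] two.
pose K x y := rho x y ^+ 2 * expR (- f y).
have Kc : continuous (fun p : Z * Z => K p.1 p.2).
  move=> p; apply: cvgM; first by apply: cvgM; exact: rc.
  apply: continuous_comp; last exact: continuous_expR.
  apply: cvgN; apply: (@continuous_comp _ _ _ snd f).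
    exact: cvg_snd.
  exact: cfun_continuous.
have /choice[y ymax] x : exists y, forall y', K x y' <= K x y.
  have [|||y _ ymax] := @compact_EVT_max Z R (K x) setT.
  - by exists x.
  - exact: compact_setT.
  - apply: continuous_subspaceT => y.
    apply: (@continuous_comp _ _ _ (pair x) (fun p : Z * Z => K p.1 p.2));
      last exact: Kc.
    by apply: cvg_pair; [exact: cvg_cst|exact: cvg_id].
  - by exists y => y'; apply: ymax; rewrite inE.
pose m x := K x (y x).
have m0 x : 0 < m x.
  have [z xz] := two x; apply: lt_le_trans (ymax x z).
  apply: mulr_gt0; last exact: expR_gt0.
  by rewrite exprn_gt0// lt_neqAle r0 andbT eq_sym; apply/eqP => /r1.
have mc : continuous m.
  by apply: (max_continuous K m) => // x; exists (y x).
have lc : continuous (fun x => ln (m x)).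
  by move=> x; apply: continuous_comp; [exact: mc|exact: continuous_ln].
have E x z : expR (ln (m x) + f z) = m x * expR (f z).
  by rewrite expRD lnK ?posrE.
have KE x z : rho x z ^+ 2 = K x z * expR (f z).
  by rewrite /K -mulrA -expRD addNr expR0 mulr1.
exists (mkcts lc); split=> [x z|x] /=.
  by rewrite E KE ler_wpM2r ?expR_ge0.
by exists (y x); rewrite E KE.
Qed.

Lemma le_conjugate {R : realType} {Z : compactMetrizableType R}
    (rho : Z -> Z -> R) (f g : cfun Z) (x : Z) (a : R) :
  is_conjugate rho f g -> (forall y, rho x y ^+ 2 <= expR (a + f y)) ->
  g x <= a.
Proof.
by move=> [_ /(_ x)[y yE]] /(_ y); rewrite yE ler_expR lerD2r.
Qed.

Lemma conjugate_anti {R : realType} {Z : compactMetrizableType R}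
    (rho : Z -> Z -> R) (f f' g g' : cfun Z) (e : R) :
  is_conjugate rho f f' -> is_conjugate rho g g' ->
  (forall x, f x <= g x + e) -> forall x, g' x <= f' x + e.
Proof.
move=> [ff' _] gg' fg x; apply: (le_conjugate _ _ _ _ _ gg') => y.
by apply: le_trans (ff' x y) _; rewrite ler_expR -addrA lerD2l addrC.
Qed.

(** The engine of the iteration. For the average m of f and f', averaging the
    bounds f' x + f y and f' y + f x for ln rho(x,y)^2 shows that the conjugate m' is at
    most m, while m <= f gives f' <= m'; so m - m' <= (f + f') / 2 - f', half of
    the original gap. *)
Lemma conjugate_midpoint {R : realType} {Z : compactMetrizableType R}
    (rho : Z -> Z -> R) (f f' m m' : cfun Z) (e : R) :
  (forall x y, rho x y = rho y x) ->
  is_conjugate rho f f' -> (forall x, f' x <= f x <= f' x + e) ->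
  m = 2^-1 *: (f + f') -> is_conjugate rho m m' ->
  forall x, m' x <= m x <= m' x + e / 2.
Proof.
move=> rs ff' gap mE mm' x.
have mxE z : m z = (f z + f' z) / 2 by rewrite mE cfunZE cfunDE mulrC.
have lo : f' x <= m' x + 0.
  apply: (conjugate_anti _ _ _ _ _ _ mm' ff') => z.
  by rewrite addr0 mxE; have /andP[? _] := gap z; lra.
apply/andP; split; last by rewrite mxE; have /andP[_ ?] := gap x; lra.
apply: (le_conjugate _ _ _ _ _ mm') => y.
(* m x + m y is the mean of the two exponents, so it is at least the smaller. *)
have h1 := ff'.1 x y; have h2 := ff'.1 y x; rewrite rs in h2.
have [h|h] := leP (f' x + f y) (f' y + f x).
- by apply: le_trans h1 _; rewrite ler_expR !mxE; lra.
- by apply: le_trans h2 _; rewrite ler_expR !mxE; lra.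
Qed.

(** * Tight functions *)

Lemma eval_cvg {R : realType} {Z : compactMetrizableType R} {T : Type}
    (F : set_system T) {FF : Filter F} (f : T -> cfun Z) (g : cfun Z) (x : Z) :
  f t @[t --> F] --> g -> f t x @[t --> F] --> g x.
Proof.
move=> fg; apply/cvgrPdist_lt => e e0.
have /cvgrPdist_lt/(_ e e0) := fg.
by apply: filterS => t; apply: le_lt_trans; exact: (abs_le_sup_norm (g - f t)).
Qed.

(** The iterated averages decrease, with the n-th step at most e / 2^(n+1), so they
    converge in C(Z). The limit dominates [rho], so it is at least its conjugate;
    conversely the conjugates of the iterates increase and are e / 2^n close to
    the iterates. *)
Lemma tight_below_exists {R : realType} {Z : compactMetrizableType R}
    (rho : Z -> Z -> R) (f f' : cfun Z) (e : R) :
  (forall x y, rho x y = rho y x) ->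
  (forall g, exists g', is_conjugate rho g g') ->
  is_conjugate rho f f' -> (forall x, f' x <= f x <= f' x + e) ->
  exists2 g, tight rho g & forall x, g x <= f x <= g x + e.
Proof.
move=> rs /choice[star starP] ff' gap.
pose F n := iter n (fun g => 2^-1 *: (g + star g)) f.
have FS n : F n.+1 = 2^-1 *: (F n + star (F n)) by [].
have FSE n x : F n.+1 x = (F n x + star (F n) x) / 2.
  by rewrite FS cfunZE cfunDE mulrC.
have gapF n x : star (F n) x <= F n x <= star (F n) x + e / 2 ^+ n.
  elim: n x => [|n IH] x.
    have -> : star (F 0%N) x = f' x.
      apply/eqP; rewrite eq_le; apply/andP; split.
        by apply: (le_conjugate _ _ _ _ _ (starP f)) => y; exact: ff'.1.
      by apply: (le_conjugate _ _ _ _ _ ff') => y; exact: (starP f).1.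
    by rewrite expr0 divr1; exact: gap.
  have -> : e / 2 ^+ n.+1 = e / 2 ^+ n / 2 by rewrite exprSr invfM mulrA.
  exact: (conjugate_midpoint rho (F n) (star (F n)) _ _ _ rs _ IH (FS n)).
have dec n x : F n.+1 x <= F n x <= F n.+1 x + e / 2 ^+ n / 2.
  by rewrite FSE; have /andP[? ?] := gapF n x; apply/andP; split; lra.
have nil a : a / 2 ^+ n @[n --> \oo] --> (0 : R).
  have -> : (fun n => a / 2 ^+ n) = geometric a 2^-1.
    by apply/funext => n; rewrite /= exprVn.
  by apply: cvg_geometric; rewrite ger0_norm ?invr_ge0// invf_lt1// ltr1n.
have [g Fg] : exists g : cfun Z, F n @[n --> \oo] --> g.
  have : cvgn (series (telescope F)).
    apply: (@normed_cvg R (cfun Z) (telescope F)).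
    apply: (@series_le_cvg _ _ (geometric (`|e| / 2) 2^-1)).
    - by move=> n; exact: normr_ge0.
    - by move=> n /=; rewrite mulr_ge0 ?exprn_ge0 ?divr_ge0.
    - move=> n /=; apply: sup_norm_le.
        by rewrite mulr_ge0 ?exprn_ge0 ?divr_ge0.
      move=> x; rewrite cfunBE exprVn.
      have /andP[h1 h2] := dec n x.
      have : e / 2 ^+ n <= `|e| / 2 ^+ n.
        by rewrite ler_wpM2r ?ler_norm// invr_ge0 exprn_ge0.
      rewrite (_ : `|e| / 2 / 2 ^+ n = `|e| / 2 ^+ n / 2); last by rewrite mulrAC.
      by rewrite ler_norml => ?; apply/andP; split; lra.
    apply: is_cvg_geometric_series.
    by rewrite ger0_norm ?invr_ge0// invf_lt1// ltr1n.
  rewrite telescopeK => /cvg_ex[l Fl]; exists (l + f).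
  have -> : F = (fun n => (F n - F 0%N) + f).
    by apply/funext => n; rewrite subrK.
  by apply: cvgD => //; exact: cvg_cst.
have Fgx x : F n x @[n --> \oo] --> g x by exact: eval_cvg Fg.
have lim_le (a : nat -> R) l b : a n @[n --> \oo] --> l ->
    (forall n, a n <= b) -> l <= b.
  by move=> al ab; apply: (cvgr_to_le al); exact: nearW.
have antitone x m n : (m <= n)%N -> F n x <= F m x.
  move=> /subnK <-; elim: (n - m)%N => // k IH.
  by rewrite addSn; have /andP[h _] := dec (k + m)%N x; exact: le_trans IH.
have gF n x : g x <= F n x.
  apply: (cvgr_to_le (Fgx x)); exists n => // k /= nk; exact: antitone.
have domg : dominated rho g g.
  move=> x y.
  have cv : expR (F n x + F n y) @[n --> \oo] --> expR (g x + g y).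
    apply: continuous_cvg; first exact: continuous_expR.
    by apply: cvgD; exact: Fgx.
  apply: (cvgr_to_ge cv); apply: nearW => n.
  apply: le_trans ((starP (F n)).1 x y) _.
  by rewrite ler_expR lerD2r; have /andP[] := gapF n x.
have gstar : star g = g.
  apply: cfunP => x; apply/eqP; rewrite eq_le; apply/andP; split.
    by apply: (le_conjugate _ _ _ _ _ (starP g)) => y; exact: domg.
  have cv : F n x - e / 2 ^+ n @[n --> \oo] --> g x.
    by rewrite -[g x]subr0; apply: cvgB; [exact: Fgx|exact: nil].
  apply: (lim_le _ _ _ cv) => n.
  have h : star (F n) x <= star g x + 0.
    apply: (conjugate_anti _ _ _ _ _ _ (starP g) (starP (F n))) => z.
    by rewrite addr0.
  by have /andP[_ ?] := gapF n x; lra.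
exists g => [|x]; first by have := starP g; rewrite gstar.
rewrite (gF 0%N) /=.
have cv : F n x + e - e / 2 ^+ n @[n --> \oo] --> g x + e.
  rewrite -[g x + e]subr0; apply: cvgB; last exact: nil.
  by apply: cvgD; [exact: Fgx|exact: cvg_cst].
apply: (cvgr_to_ge cv); apply: nearW.
elim=> [|n IH]; first by rewrite expr0 divr1 addrK.
apply: le_trans IH _; have /andP[_] := dec n x.
rewrite (_ : e / 2 ^+ n.+1 = e / 2 ^+ n / 2); first by lra.
by rewrite exprSr invfM mulrA.
Qed.

(** The iteration is started at u', not at u, since a function at most its
    conjugate is on the wrong side: from u <= u' <= u + e, conjugation yields
    u' - e <= u'' <= u' for the conjugate u'' of u'. *)
Lemma tight_near_exists {R : realType} {Z : compactMetrizableType R}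
    (rho : Z -> Z -> R) (u u' : cfun Z) :
  (forall x y, rho x y = rho y x) ->
  (forall g, exists g', is_conjugate rho g g') ->
  is_conjugate rho u u' -> (forall x, u x <= u' x) ->
  exists2 g, tight rho g & `|g - u| <= 2 * `|u' - u|.
Proof.
move=> rs ex uu' le; have [u'' u'u''] := ex u'.
pose e : R := `|u' - u|.
have u'e x : u' x <= u x + e.
  have : `|u' x - u x| <= e := abs_le_sup_norm (u' - u) x.
  by rewrite ler_norml => /andP[_]; lra.
have [|g gt gE] := tight_below_exists rho u' u'' e rs ex u'u''.
  move=> x; apply/andP; split.
    rewrite -[u' x]addr0; apply: (conjugate_anti _ _ _ _ _ _ uu' u'u'') => z.
    by rewrite addr0.
  exact: (conjugate_anti _ _ _ _ _ _ u'u'' uu').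
exists g => //; apply: sup_norm_le; first by rewrite mulr_ge0 ?normr_ge0.
move=> x; rewrite cfunBE -/e.
have /andP[h1 h2] := gE x; have := u'e x; have := le x.
by rewrite ler_norml => ? ?; apply/andP; split; lra.
Qed.

(** * The conjugation gap along an odd direction *)

Lemma antipodal_le1 {R : realType} {Z : compactMetrizableType R}
    (rho : Z -> Z -> R) x y : antipodal rho -> rho x y <= 1.
Proof.
move=> [_ rsup _].
(* A set without a supremum has sup 0, which is not 1. *)
have hs : has_sup (range (fun p : Z * Z => rho p.1 p.2)).
  by apply: contrapT => /sup_out; rewrite rsup => /eqP; rewrite oner_eq0.
by rewrite -rsup; apply: ub_le_sup; [exact: hs.2|exists (x, y)].
Qed.

(** This bounds the conjugate of - t v by - t v + d |t|, for arbitrarily small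
    d, when t is near 0. By compactness it is enough to argue near each pair
    (x, y): if rho(x,y) = 1, then |v x' + v y'| < d nearby and the bound is at
    least 1; otherwise rho^2 < 1, while the bound tends to 1 as t tends to 0. *)
Lemma odd_small_gap {R : realType} {Z : compactMetrizableType R}
    (rho : Z -> Z -> R) (v : cfun Z) (d : R) :
  antipodal rho -> odd_functions rho v -> 0 < d ->
  \forall t \near (0 : R),
    dominated rho (fun x => - (t * v x) + d * `|t|) (fun y => - (t * v y)).
Proof.
move=> arho vodd d0; have le1 x y := antipodal_le1 rho x y arho.
have [[rc r0 _ _] _ _] := arho.
have cov : near_covering [set: Z * Z].
  apply/compact_near_coveringP; rewrite -setXTT.
  by apply: compact_setX; exact: compact_setT.
have vc (p : Z * Z) : v q.1 + v q.2 @[q --> p] --> v p.1 + v p.2.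
  apply: cvgD.
    by apply: (@continuous_comp _ _ _ fst v);
      [exact: cvg_fst|exact: cfun_continuous].
  by apply: (@continuous_comp _ _ _ snd v);
      [exact: cvg_snd|exact: cfun_continuous].
suff : \forall t \near (0 : R), [set: Z * Z] `<=`
    (fun p => rho p.1 p.2 ^+ 2 <= expR (d * `|t| - t * (v p.1 + v p.2))).
  apply: filterS => t H x y; have := H (x, y) I; rewrite /=.
  by congr (_ <= expR _); lra.
apply: (cov R (nbhs (0:R)) (fun (t : R) p =>
  rho p.1 p.2 ^+ 2 <= expR (d * `|t| - t * (v p.1 + v p.2)))) => -[x y] _.
have [rxy|rxy] := eqVneq (rho x y) 1.
  have /cvgrPdist_lt/(_ d d0) := vc (x, y).
  rewrite /= (vodd _ _ rxy) => near_v.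
  exists ([set p : Z * Z | `|0 - (v p.1 + v p.2)| < d], setT).
    by split=> //; exact: filterT.
  move=> [[x' y'] t] /= [vd _].
  apply: (@le_trans _ _ 1); first by rewrite expr_le1.
  rewrite -[leLHS]expR0 ler_expR subr_ge0.
  apply: le_trans (ler_norm _) _; rewrite normrM mulrC.
  by rewrite ler_wpM2r// ltW// -normrN -sub0r.
have r1 : rho x y ^+ 2 < 1.
  by rewrite expr_lt1// lt_neqAle rxy le1.
pose G (q : (Z * Z) * R) := expR (d * `|q.2| - q.2 * (v q.1.1 + v q.1.2)) -
  rho q.1.1 q.1.2 ^+ 2.
have Gc : {for ((x, y), 0), continuous G}.
  apply: cvgB; last first.
    have rc1 : rho q.1.1 q.1.2 @[q --> ((x, y), 0 : R)] --> rho x y.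
      exact: (@continuous_comp _ _ _ fst (fun p : Z * Z => rho p.1 p.2)
        ((x, y), 0 : R) cvg_fst (rc _)).
    by apply: cvgM.
  apply: continuous_cvg; first exact: continuous_expR.
  apply: cvgB.
    apply: cvgM; first exact: cvg_cst.
    by apply: cvg_norm; exact: cvg_snd.
  apply: cvgM; first exact: cvg_snd.
  exact: (@continuous_comp _ _ _ fst (fun p : Z * Z => v p.1 + v p.2)
    ((x, y), 0 : R) cvg_fst (vc _)).
have G0 : 0 < G ((x, y), 0).
  by rewrite /G /= normr0 mulr0 mul0r subr0 expR0 subr_gt0.
have [[A B] /= [Axy B0] AB] := cvgr_gt _ Gc _ G0.
exists (A, B) => // -[p t] /= Apt.
by have := AB (p, t) Apt; rewrite /G /= subr_gt0 => /ltW.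
Qed.

(** In the maximum defining u' x, an antipode y of x contributes
    - u y = u x. *)
Lemma odd_le_conjugate {R : realType} {Z : compactMetrizableType R}
    (rho : Z -> Z -> R) (u u' : cfun Z) x :
  antipodal rho -> odd_functions rho u -> is_conjugate rho u u' ->
  u x <= u' x.
Proof.
move=> [_ _ /(_ x)[y rxy]] uodd [/(_ x y) h _].
move: h; rewrite rxy expr1n -[leLHS]expR0 ler_expR.
by have := uodd x y rxy; lra.
Qed.

(** * Rescaling an antipodal function *)

Definition rescale {R : realType} {Z : compactMetrizableType R}
    (rho : Z -> Z -> R) (f : cfun Z) (x y : Z) : R :=
  rho x y * expR (- (f x + f y) / 2).

Lemma rescale_sqr {R : realType} {Z : compactMetrizableType R}
    (rho : Z -> Z -> R) (f : cfun Z) x y :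
  rescale rho f x y ^+ 2 = rho x y ^+ 2 * expR (- (f x + f y)).
Proof.
by rewrite /rescale exprMn [expR _ ^+ 2]expr2 -expRD; congr (_ * expR _); lra.
Qed.

Lemma rescale0 {R : realType} {Z : compactMetrizableType R}
    (rho : Z -> Z -> R) : rescale rho 0 = rho.
Proof.
apply/funext => x; apply/funext => y.
by rewrite /rescale !cfun0E addr0 oppr0 mul0r expR0 mulr1.
Qed.

Lemma separating_rescale {R : realType} {Z : compactMetrizableType R}
    (rho : Z -> Z -> R) (f : cfun Z) :
  separating rho -> separating (rescale rho f).
Proof.
move=> [rc r0 rs r1]; split.
- move=> p; apply: cvgM; first exact: rc.
  apply: continuous_comp; last exact: continuous_expR.
  apply: cvgM; last exact: cvg_cst.
  apply: cvgN; apply: cvgD.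
    by apply: (@continuous_comp _ _ _ fst f);
      [exact: cvg_fst|exact: cfun_continuous].
  by apply: (@continuous_comp _ _ _ snd f);
      [exact: cvg_snd|exact: cfun_continuous].
- by move=> x y; rewrite mulr_ge0 ?expR_ge0.
- by move=> x y; rewrite /rescale rs (addrC (f x)).
- move=> x y; rewrite -r1 /rescale; split => [/eqP|->]; last by rewrite mul0r.
  by rewrite mulf_eq0 (gt_eqF (expR_gt0 _)) orbF => /eqP.
Qed.

(** Tightness is antipodality of the rescaling: domination says that the rescaled
    function is at most 1, and attainment that every point has an antipode. *)
Lemma antipodal_rescale {R : realType} {Z : compactMetrizableType R}
    (rho : Z -> Z -> R) (f : cfun Z) :
  [set: Z] !=set0 -> separating rho -> tight rho f ->
  antipodal (rescale rho f).
Proof.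
move=> [z _] rsep [fd fa]; have sep := separating_rescale rho f rsep.
have [_ s0 _ _] := sep.
have le1 x y : rescale rho f x y <= 1.
  rewrite -(@expr_le1 _ 2)// rescale_sqr expRN.
  by rewrite ler_pdivrMr ?expR_gt0// mul1r; exact: fd.
have att x : exists y, rescale rho f x y = 1.
  have [y yE] := fa x; exists y; apply/eqP.
  by rewrite -(@pexpr_eq1 _ _ 2)// rescale_sqr yE -expRD addrN expR0.
split=> //; apply/eqP; rewrite eq_le; apply/andP; split.
  apply: ge_sup; first by exists (rescale rho f z z); exists (z, z).
  by move=> _ [p _ <-].
have [y <-] := att z; apply: ub_le_sup; last by exists (z, y).
by exists 1 => _ [p _ <-].
Qed.

Lemma moebius_rescale {R : realType} {Z : compactMetrizableType R}
    (rho : Z -> Z -> R) (f : cfun Z) :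
  moebius_equivalent (rescale rho f) rho.
Proof.
move=> x x' y y' _; rewrite /cross_ratio /rescale.
(* Each of the two products involves all four points once. *)
pose E := expR (- (f x + f x' + f y + f y') / 2).
have fold a b p q r s : p + q + r + s = f x + f x' + f y + f y' ->
    a * expR (- (p + q) / 2) * (b * expR (- (r + s) / 2)) = a * b * E.
  by move=> h; rewrite mulrACA -expRD /E -h; congr (_ * expR _); lra.
by rewrite !fold ?[RHS]/E; [|lra..]; rewrite -mulf_div divff ?mulr1 ?gt_eqF ?expR_gt0.
Qed.

Lemma phiE {R : realType} {Z : compactMetrizableType R}
    (rho beta : Z -> Z -> R) x :
  phi rho beta x = ln (moebius_derivative rho beta x).
Proof. by []. Qed.

(** Three distinct points make the derivative unique: the pairwise sums of its
    logarithms over x, y, z determine the value at x. *)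
Lemma phi_rescale {R : realType} {Z : compactMetrizableType R}
    (rho : Z -> Z -> R) (f : cfun Z) :
  (forall x : Z, exists y z, [/\ x <> y, x <> z & y <> z]) ->
  separating rho -> phi rho (rescale rho f) = - f.
Proof.
move=> three [_ _ _ r1]; apply: cfunP => x; rewrite cfunNE phiE /moebius_derivative.
have fc : continuous (fun x => expR (- f x)).
  move=> z; apply: continuous_comp; last exact: continuous_expR.
  by apply: cvgN; exact: cfun_continuous.
case: xgetP => [h _ [hc h0 hE]|/(_ (fun x => expR (- f x)))]; last first.
  case; split=> // [y|y z]; first exact: expR_gt0.
  by rewrite rescale_sqr mulrC -expRD opprD.
have key y z : y <> z -> ln (h y) + ln (h z) = - f y + - f z.
  move=> yz; rewrite -lnM ?posrE//.
  have : h y * h z * rho y z ^+ 2 = expR (- f y + - f z) * rho y z ^+ 2.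
    by rewrite -hE rescale_sqr opprD mulrC.
  move=> /mulIf ->; first by rewrite expRK.
  by rewrite sqrf_eq0; apply/eqP => /r1.
have [y [z [xy xz yz]]] := three x.
by have := key _ _ xy; have := key _ _ xz; have := key _ _ yz; lra.
Qed.

(** * Tangent vectors are odd *)

(** The sum is ln beta(x,y)^2, and beta <= 1. *)
Lemma phi_antipodal_le0 {R : realType} {Z : compactMetrizableType R}
    (rho beta : Z -> Z -> R) x y :
  antipodal beta -> rho x y = 1 -> phi rho beta x + phi rho beta y <= 0.
Proof.
move=> ab rxy; rewrite !phiE /moebius_derivative.
(* The default derivative 1 has logarithm 0. *)
case: xgetP => [h _ [hc h0 hE]|_]; last by rewrite !ln1 addr0.
rewrite -lnM ?posrE// ln_le0//.
have := hE x y; rewrite rxy expr1n mulr1 => <-.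
by have [[_ b0 _ _] _ _] := ab; rewrite expr_le1// antipodal_le1.
Qed.

Lemma phi_self_eq0 {R : realType} {Z : compactMetrizableType R}
    (rho : Z -> Z -> R) x y :
  rho x y = 1 -> phi rho rho x + phi rho rho y = 0.
Proof.
move=> rxy; rewrite !phiE /moebius_derivative.
case: xgetP => [h _ [hc h0 hE]|_]; last by rewrite !ln1 addr0.
rewrite -lnM ?posrE//.
by have := hE x y; rewrite rxy expr1n mulr1 => <-; rewrite ln1.
Qed.

(** Along the curve, s h = phi(c h)(x) + phi(c h)(y) has a maximum 0 at h = 0, so
    the quotients s h / h are nonpositive on the right and nonnegative on the
    left. *)
Lemma tangent_sub_odd {R : realType} {Z : compactMetrizableType R}
    (rho0 rho : Z -> Z -> R) : tangent_space rho0 rho `<=` odd_functions rho.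
Proof.
move=> _ [eps [c [[eps0 cM c0 dc] ->]]] x y rxy.
set v : cfun Z := 'D_1 (fun t : R => phi rho (c t)) 0.
pose q (h : R) : cfun Z := h^-1 *: (phi rho (c h) - phi rho (c 0)).
have qv : q h @[h --> 0^'] --> v.
  have -> : q = (fun h : R => h^-1 *:
      (((fun t : R => phi rho (c t)) \o shift 0) (h *: (1 : R)) -
       phi rho (c 0))).
    by apply/funext => h; rewrite /q /= addr0 /GRing.scale /= mulr1.
  exact: dc.
pose s h : R := phi rho (c h) x + phi rho (c h) y.
have qs : s h / h @[h --> 0^'] --> v x + v y.
  have -> : (fun h => s h / h) = (fun h => q h x + q h y).
    apply/funext => h; rewrite /q !cfunZE !cfunBE /s.
    by rewrite c0 -mulrDr addrACA -opprD phi_self_eq0// subr0 mulrC.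
  by apply: cvgD; exact: eval_cvg.
have s0 : \forall h \near (0 : R), s h <= 0.
  exists eps => // h /=; rewrite sub0r normrN => he.
  apply: phi_antipodal_le0 => //.
  by have [] := cM h; rewrite // in_itv /= -ltr_norml.
apply/eqP; rewrite eq_le; apply/andP; split.
- have qr : s h / h @[h --> 0^'+] --> v x + v y.
    exact: cvg_dnbhs_at_right qs.
  apply: (cvgr_to_le qr); near=> h.
  have h0 : 0 < h by near: h; exact: nbhs_right_gt.
  rewrite pmulr_lle0 ?invr_gt0//; near: h; exact: cvg_within.
- have ql : s h / h @[h --> 0^'-] --> v x + v y.
    exact: cvg_dnbhs_at_left qs.
  apply: (cvgr_to_ge ql); near=> h.
  have h0 : h < 0 by near: h; exact: nbhs_left_lt.
  rewrite nmulr_lge0 ?invr_lt0//; near: h; exact: cvg_within.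
Unshelve. all: by end_near.
Qed.

(** * Odd functions are tangent *)

(** The curve is t |-> rescale rho (g t), with g t tight and within twice the gap
    of - t v. That gap is o(t), so phi rho (c t) = - g t has derivative v, and
    it is 0 at t = 0, so the curve starts at rho. *)
Lemma odd_sub_tangent {R : realType} {Z : compactMetrizableType R}
    (rho0 rho : Z -> Z -> R) :
  (forall x : Z, exists y z, [/\ x <> y, x <> z & y <> z]) ->
  [set: Z] !=set0 ->
  moebius_space rho0 rho -> odd_functions rho `<=` tangent_space rho0 rho.
Proof.
move=> three Z0 [arho mrho] v vodd.
have [rsep _ _] := arho; have [_ _ rs _] := rsep.
have conj f : exists g, is_conjugate rho f g.
  apply: conjugate_exists => // x.
  by have [y [_ [xy _ _]]] := three x; exists y.
have /choice[u' u'P] := fun t : R => conj (- (t *: v)).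
have uodd t : odd_functions rho (- (t *: v)).
  move=> x y /vodd; rewrite !cfunNE !cfunZE -opprD -mulrDr => ->.
  by rewrite mulr0 oppr0.
have /choice[g gP] : forall t : R, exists g, tight rho g /\
    `|g - (- (t *: v))| <= 2 * `|u' t - (- (t *: v))|.
  move=> t; have [g ? ?] := tight_near_exists rho _ _ rs conj (u'P t)
    (fun x => odd_le_conjugate _ _ _ x arho (uodd t) (u'P t)).
  by exists g.
have small d : 0 < d -> \forall t \near (0 : R), `|g t + t *: v| <= d * `|t|.
  move=> d0; have d2 : 0 < d / 2 by rewrite divr_gt0.
  have := odd_small_gap rho v _ arho vodd d2.
  apply: filterS => t dom; have [_] := gP t; rewrite opprK.
  move=> /le_trans; apply.
  suff h : `|u' t + t *: v| <= d / 2 * `|t| by lra.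
  apply: sup_norm_le => [|x]; first by rewrite mulr_ge0// ltW.
  have lo := odd_le_conjugate _ _ _ x arho (uodd t) (u'P t).
  have hi : u' t x <= - (t * v x) + d / 2 * `|t|.
    by apply: (le_conjugate _ _ _ _ _ (u'P t)) => y; exact: dom.
  move: lo; rewrite cfunNE cfunZE cfunDE cfunZE => lo.
  by rewrite ler_norml; apply/andP; split; lra.
have g0 : g 0 = 0.
  have := nbhs_singleton (small 1 ltr01).
  by rewrite normr0 mulr0 scale0r addr0 normr_le0 => /eqP.
pose c t := rescale rho (g t).
have phic t : phi rho (c t) = - g t by exact: phi_rescale.
have D : h^-1 *: (((fun t : R => phi rho (c t)) \o shift 0) (h *: (1 : R))
    - phi rho (c 0)) @[h --> 0^'] --> v.
  apply/cvgrPdist_le => e e0.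
  near=> h.
  have h0 : h != 0 by near: h; exact: nbhs_dnbhs_neq.
  have sm : `|g h + h *: v| <= e * `|h|.
    by near: h; apply: nbhs_dnbhs; exact: small.
  rewrite /= addr0 (_ : h *: (1 : R) = h); last by rewrite /GRing.scale /= mulr1.
  rewrite !phic g0 oppr0 subr0 scalerN opprK.
  rewrite -[X in `|X + _|](scalerK h0) -scalerDr normrZ normfV.
  by rewrite ler_pdivrMl ?normr_gt0// addrC mulrC.
exists 1, c; split; last by apply/esym/cvg_lim.
split=> //.
- move=> t _; split.
    by apply: antipodal_rescale => //; have [] := gP t.
  by move=> x x' y y' un; rewrite -mrho//; exact: moebius_rescale.
- by rewrite /c g0 rescale0.
- by apply/cvg_ex; exists v.
Unshelve. all: by end_near.
Qed.

(** * The space of odd functions *)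

Lemma odd_functions_submod {R : realType} {Z : compactMetrizableType R}
    (rho : Z -> Z -> R) : submod_closed (mem (odd_functions rho)).
Proof.
split=> [|a u v]; rewrite !inE.
  by move=> x y _; rewrite !cfun0E addr0.
move=> uo vo x y rxy; rewrite !cfunDE !cfunZE addrACA -mulrDr.
by rewrite uo// vo// mulr0 addr0.
Qed.

Lemma odd_functions_closed {R : realType} {Z : compactMetrizableType R}
    (rho : Z -> Z -> R) : closed (odd_functions rho).
Proof.
have -> : odd_functions rho = \bigcap_(p in [set p : Z * Z | rho p.1 p.2 = 1])
    [set v : cfun Z | v p.1 + v p.2 = 0].
  apply/seteqP; split => [v vo [x y]|v vo x y rxy]; first exact: vo.
  exact: (vo (x, y)).
apply: closed_bigI => p _.
have ec y : continuous (fun v : cfun Z => v y).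
  by move=> v; exact: (eval_cvg (nbhs v) id v).
have sc : continuous (fun v : cfun Z => v p.1 + v p.2).
  by move=> v; exact: cvgD (ec _ v) (ec _ v).
apply: (@closed_comp _ _ (fun v : cfun Z => v p.1 + v p.2) [set 0]) => [v _|].
  exact: sc.
exact: closed_eq.
Qed.

Lemma closed_complete {R : realType} {V : completeNormedModType R} (A : set V) :
  closed A -> complete_set A.
Proof.
move=> cA F FF FA /cauchy_cvg/cvg_ex[l Fl]; exists l => //.
exact: (closed_cvg A cA FA l Fl).
Qed.

Lemma three_points {R : realType} {Z : compactMetrizableType R} (s : seq Z) :
  uniq s -> (2 < size s)%N ->
  forall x : Z, exists y z, [/\ x <> y, x <> z & y <> z].
Proof.
case: s => [|a [|b [|c s]]]//=; rewrite !inE !negb_or.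
move=> /and4P[/and3P[/eqP ab /eqP ac _] /andP[/eqP bc _] _ _] _ x.
have [->|/eqP xa] := eqVneq x a; first by exists b, c.
have [->|/eqP xb] := eqVneq x b; last by exists a, b.
by exists a, c; split=> // /esym.
Qed.

Theorem theorem1p11 (R : realType) (Z : compactMetrizableType R)
    (card_Z : exists s : seq Z, uniq s /\ size s = 4%N)
    (rho0 : Z -> Z -> R) (antipodal_rho0 : antipodal rho0)
    (rho : Z -> Z -> R) (rho_in : moebius_space rho0 rho) :
  tangent_space rho0 rho = odd_functions rho /\
  [/\ submod_closed (mem (tangent_space rho0 rho)),
      closed (tangent_space rho0 rho)
    & complete_set (tangent_space rho0 rho)].
Proof.
have [s [us ss]] := card_Z.
have three : forall x : Z, exists y z, [/\ x <> y, x <> z & y <> z].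
  by apply: (three_points s us); rewrite ss.
have Z0 : [set: Z] !=set0.
  by case: s ss {us} => // z s _; exists z.
have -> : tangent_space rho0 rho = odd_functions rho.
  apply/seteqP; split; first exact: tangent_sub_odd.
  exact: odd_sub_tangent.
split=> //; split.
- exact: odd_functions_submod.
- exact: odd_functions_closed.
- by apply: closed_complete; exact: odd_functions_closed.
Qed.
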